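(* Let $u_1,u_2,v_1,v_2$ be arbitrary integers, and define integers $a_1,\ldots,a_4$ and $b_1,\ldots,b_4$ by \[ \begin{aligned} a_1 & = (v_1^4-6v_1^2v_2^2+v_2^4)^2(v_1^2-v_2^2)^2(u_1^2+u_2^2)^2,\\ a_2 & = (v_1^4-6v_1^2v_2^2+v_2^4)^2(v_1^2+v_2^2)^2(u_1^2-u_2^2)^2,\\ a_3 & = (v_1^2-v_2^2)^2\bigl((v_1^2+v_2^2)^2u_1^2-16u_1u_2v_1^2v_2^2-(v_1^2+v_2^2)^2u_2^2\bigr)^2,\\ a_4 & = (v_1^2-v_2^2)^2\bigl((v_1^2+v_2^2)^2u_1^2+16u_1u_2v_1^2v_2^2-(v_1^2+v_2^2)^2u_2^2\bigr)^2,\\ b_1 & = 0,\\ b_2 & = (v_1^4-6v_1^2v_2^2+v_2^4)^2\bigl((v_2-v_1)u_1+(v_1+v_2)u_2\bigr)\bigl((v_1+v_2)u_1+(v_1-v_2)u_2\bigr)\\ &\quad\times\bigl((v_1-v_2)u_1+(v_1+v_2)u_2\bigr)\bigl((v_1+v_2)u_1-(v_1-v_2)u_2\bigr),\\ b_3 & = -(v_1^2-v_2^2)^2\bigl((v_1^2+v_2^2)u_1+4u_1v_1v_2-(v_1^2+v_2^2)u_2\bigr)\bigl((v_1^2+v_2^2)u_1-4u_1v_1v_2-(v_1^2+v_2^2)u_2\bigr)\\ &\quad\times\bigl((v_1^2+v_2^2)u_1+4u_2v_1v_2+(v_1^2+v_2^2)u_2\bigr)\bigl((v_1^2+v_2^2)u_1-4u_2v_1v_2+(v_1^2+v_2^2)u_2\bigr),\\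 b_4 & = -(v_1^2-v_2^2)^2\bigl((v_1^2+v_2^2)u_1+4u_1v_1v_2+(v_1^2+v_2^2)u_2\bigr)\bigl((v_1^2+v_2^2)u_1-4u_1v_1v_2+(v_1^2+v_2^2)u_2\bigr)\\ &\quad\times\bigl((v_1^2+v_2^2)u_1+4u_2v_1v_2-(v_1^2+v_2^2)u_2\bigr)\bigl((v_1^2+v_2^2)u_1-4u_2v_1v_2-(v_1^2+v_2^2)u_2\bigr). \end{aligned} \] Then all the 16 sums $a_i+b_j$, $i=1,\ldots,4$, $j=1,\ldots,4$, are perfect squares.
   Context: A perfect square is the square of an integer. *)

(* Defs.v *)
From mathcomp Require Import all_boot all_algebra.

Set Implicit Arguments.
Unset Strict Implicit.
Unset Printing Implicit Defensive.

Import GRing.Theory.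
Local Open Scope ring_scope.

Definition perfect_square (n : int) : Prop := exists k : int, n = k ^+ 2.

(* In both tuples, component i : 'I_4 (counted from 0) is a_{i+1}, resp. b_{i+1}. *)
Definition a_tuple (u1 u2 v1 v2 : int) : 4.-tuple int :=
  [tuple
     (v1 ^+ 4 - 6 * v1 ^+ 2 * v2 ^+ 2 + v2 ^+ 4) ^+ 2
       * (v1 ^+ 2 - v2 ^+ 2) ^+ 2 * (u1 ^+ 2 + u2 ^+ 2) ^+ 2;
     (v1 ^+ 4 - 6 * v1 ^+ 2 * v2 ^+ 2 + v2 ^+ 4) ^+ 2
       * (v1 ^+ 2 + v2 ^+ 2) ^+ 2 * (u1 ^+ 2 - u2 ^+ 2) ^+ 2;
     (v1 ^+ 2 - v2 ^+ 2) ^+ 2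
       * ((v1 ^+ 2 + v2 ^+ 2) ^+ 2 * u1 ^+ 2
          - 16 * u1 * u2 * v1 ^+ 2 * v2 ^+ 2
          - (v1 ^+ 2 + v2 ^+ 2) ^+ 2 * u2 ^+ 2) ^+ 2;
     (v1 ^+ 2 - v2 ^+ 2) ^+ 2
       * ((v1 ^+ 2 + v2 ^+ 2) ^+ 2 * u1 ^+ 2
          + 16 * u1 * u2 * v1 ^+ 2 * v2 ^+ 2
          - (v1 ^+ 2 + v2 ^+ 2) ^+ 2 * u2 ^+ 2) ^+ 2].

Definition b_tuple (u1 u2 v1 v2 : int) : 4.-tuple int :=
  [tuple
     0;
     (v1 ^+ 4 - 6 * v1 ^+ 2 * v2 ^+ 2 + v2 ^+ 4) ^+ 2
       * ((v2 - v1) * u1 + (v1 + v2) * u2)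
       * ((v1 + v2) * u1 + (v1 - v2) * u2)
       * ((v1 - v2) * u1 + (v1 + v2) * u2)
       * ((v1 + v2) * u1 - (v1 - v2) * u2);
     - (v1 ^+ 2 - v2 ^+ 2) ^+ 2
       * ((v1 ^+ 2 + v2 ^+ 2) * u1 + 4 * u1 * v1 * v2 - (v1 ^+ 2 + v2 ^+ 2) * u2)
       * ((v1 ^+ 2 + v2 ^+ 2) * u1 - 4 * u1 * v1 * v2 - (v1 ^+ 2 + v2 ^+ 2) * u2)
       * ((v1 ^+ 2 + v2 ^+ 2) * u1 + 4 * u2 * v1 * v2 + (v1 ^+ 2 + v2 ^+ 2) * u2)
       * ((v1 ^+ 2 + v2 ^+ 2) * u1 - 4 * u2 * v1 * v2 + (v1 ^+ 2 + v2 ^+ 2) * u2);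
     - (v1 ^+ 2 - v2 ^+ 2) ^+ 2
       * ((v1 ^+ 2 + v2 ^+ 2) * u1 + 4 * u1 * v1 * v2 + (v1 ^+ 2 + v2 ^+ 2) * u2)
       * ((v1 ^+ 2 + v2 ^+ 2) * u1 - 4 * u1 * v1 * v2 + (v1 ^+ 2 + v2 ^+ 2) * u2)
       * ((v1 ^+ 2 + v2 ^+ 2) * u1 + 4 * u2 * v1 * v2 - (v1 ^+ 2 + v2 ^+ 2) * u2)
       * ((v1 ^+ 2 + v2 ^+ 2) * u1 - 4 * u2 * v1 * v2 - (v1 ^+ 2 + v2 ^+ 2) * u2)].

(* Main.v *)
Require Import Defs.
From mathcomp Require Import all_boot all_algebra.
From mathcomp Require Import ring.
Local Open Scope ring_scope.

(** The squares rest on [p ^+ 2 = m ^+ 2 + 4 * w ^+ 2], [D = m ^+ 2 - 4 * w ^+ 2] and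
    [n ^+ 2 = d ^+ 2 + 4 * t ^+ 2]. For instance b_2 equals [D ^+ 2 * (4 * p ^+ 2 * t ^+ 2 - m ^+ 2
    * n ^+ 2)]: adding a_1 cancels the last term, and adding a_2 leaves
    [D ^+ 2 * n ^+ 2 * (p ^+ 2 - m ^+ 2)]. *)

(* Entry (i, j) is the polynomial square root of a_{i+1} + b_{j+1}: the sum is a
   quartic form in u1, u2 and its root a quadratic form in u1, u2. *)
Definition sum_sqrt (u1 u2 v1 v2 : int) : seq (seq int) :=
  let D := v1 ^+ 4 - 6 * v1 ^+ 2 * v2 ^+ 2 + v2 ^+ 4 in
  let m := v1 ^+ 2 - v2 ^+ 2 in
  let p := v1 ^+ 2 + v2 ^+ 2 in
  let w := v1 * v2 in
  let n := u1 ^+ 2 + u2 ^+ 2 in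
  let d := u1 ^+ 2 - u2 ^+ 2 in
  let t := u1 * u2 in
  [:: [:: D * m * n;
          2 * D * p * t;
          2 * m * (4 * w ^+ 2 * d + p ^+ 2 * t);
          2 * m * (4 * w ^+ 2 * d - p ^+ 2 * t)];
      [:: D * p * d;
          2 * D * w * n;
          2 * w * (p ^+ 2 * d + 4 * m ^+ 2 * t);
          2 * w * (p ^+ 2 * d - 4 * m ^+ 2 * t)];
      [:: m * (p ^+ 2 * d - 16 * w ^+ 2 * t);
          4 * w * (m ^+ 2 * d - p ^+ 2 * t);
          4 * m * p * w * n;
          4 * m * p * w * (d - 2 * t)];
      [:: m * (p ^+ 2 * d + 16 * w ^+ 2 * t);
          4 * w * (m ^+ 2 * d + p ^+ 2 * t);
          4 * m * p * w * (d + 2 * t);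
          4 * m * p * w * n]].

Theorem theorem3 (u1 u2 v1 v2 : int) (i j : 'I_4) :
  perfect_square (tnth (a_tuple u1 u2 v1 v2) i + tnth (b_tuple u1 u2 v1 v2) j).
Proof.
exists (nth 0 (nth [::] (sum_sqrt u1 u2 v1 v2) i) j).
rewrite !(tnth_nth 0).
(* Indices from 4 on contradict the bound of ['I_4]; each of the 16 remaining pairs is a polynomial
   identity in [u1], [u2], [v1], [v2]. *)
by case: i j => [[|[|[|[|//]]]] ?] [[|[|[|[|//]]]] ?] /=; ring.
Qed.
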